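(* Let $A_{j-1},A_j\in\mathbb{R}^{n\times n}$ be symmetric positive definite, let $b_{j-1},b_j,\bar x_{j-1},\bar x_j\in\mathbb{R}^n$, and let $x_{j-1}^\star,x_j^\star$ be the solutions of $A_{j-1}x_{j-1}^\star=b_{j-1}$ and $A_jx_j^\star=b_j$. Let $C\in\mathbb{R}^{q\times n}$, let $Z_j\in\mathbb{R}^{n\times z_j}$ have full column rank, and let $\mathcal{Z}_j=\mathrm{range}(Z_j)$. Define the ideal weights $$\eta_j^\star=(Z_j^TA_jZ_j)^{-1}Z_j^T(b_j-A_j\bar x_j),\qquad \bar\eta_j^\star=(CZ_j)^+C(x_j^\star-\bar x_j),$$ and the previous weights $$\eta_j^{\mathrm{prev}}=(Z_j^TA_{j-1}Z_j)^{-1}Z_j^T(b_{j-1}-A_{j-1}\bar x_{j-1}).$$ Then $$\|\eta_j^\star-\eta_j^{\mathrm{prev}}\|\le\frac1{\sigma_{\min}}\Big(\big\|P_{A_j}^{\mathcal{Z}_j}-P_{A_{j-1}}^{\mathcal{Z}_j}\big\|\,\|x_j^\star-\bar x_j\|+\sigma_1\big\|(x_j^\star-\bar x_j)-(x_{j-1}^\star-\bar x_{j-1})\big\|\Big)$$ and $$\|\bar\eta_j^\star-\eta_j^{\mathrm{prev}}\|\le\frac1{\sigma_{\min}}\Big(\big\|P_{C^TC}^{\mathcal{Z}_j}-P_{A_{j-1}}^{\mathcal{Z}_j}\big\|\,\|x_j^\star-\bar x_j\|+\sigma_1\big\|(x_j^\star-\bar x_j)-(x_{j-1}^\star-\bar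 x_{j-1})\big\|\Big),$$ where $\sigma_{\min}$ is the smallest singular value of $Z_j$ and $\sigma_1$ is the largest singular value of $P_{A_{j-1}}^{\mathcal{Z}_j}$.
   Context: $\|\cdot\|$ is the Euclidean vector norm and the induced spectral matrix norm; a superscript $+$ denotes the Moore–Penrose pseudoinverse. For $A$ symmetric positive definite, $P_A^{\mathcal{Z}_j}=Z_j(Z_j^TAZ_j)^{-1}Z_j^TA$ is the $A$-orthogonal projector onto $\mathcal{Z}_j$ (as an $n\times n$ matrix), and for the pseudometric $C^TC$, $P_{C^TC}^{\mathcal{Z}_j}=Z_j(CZ_j)^+C$. *)

(* Defs.v *)
From mathcomp Require Import all_boot all_order all_algebra.
From mathcomp Require Import boolp classical_sets reals.
From mathcomp Require Import spectral polyrcf complex.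

Set Implicit Arguments.
Unset Strict Implicit.
Unset Printing Implicit Defensive.

Import Order.TTheory GRing.Theory Num.Theory.
Local Open Scope classical_set_scope.
Local Open Scope ring_scope.

Definition vnorm (R : realType) (n : nat) (x : 'cV[R]_n) : R :=
  Num.sqrt (\sum_(i < n) x i 0 ^+ 2).

(* The unit ball, rather than the unit sphere, keeps the set nonempty for
   [n = 0]. *)
Definition mnorm (R : realType) (m n : nat) (A : 'M[R]_(m, n)) : R :=
  sup [set vnorm (A *m x) | x in [set x : 'cV[R]_n | vnorm x <= 1]].

Definition spd (R : realType) (n : nat) (A : 'M[R]_n) : Prop :=
  A^T = A /\ forall x : 'cV[R]_n, x != 0 -> 0 < (x^T *m A *m x) 0 0.

(* MathComp's [pinvmx] is a generalized inverse, but it need not satisfy the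
   last two Penrose equations. *)
Definition is_moore_penrose (R : realType) (m n : nat)
    (A : 'M[R]_(m, n)) (X : 'M[R]_(n, m)) : Prop :=
  [/\ A *m X *m A = A, X *m A *m X = X,
      (A *m X)^T = A *m X & (X *m A)^T = X *m A].

Definition mpinv (R : realType) (m n : nat) (A : 'M[R]_(m, n)) : 'M[R]_(n, m) :=
  xget 0 [set X | is_moore_penrose A X].

(* The singular values of an [m x n] matrix are the square roots of the
   eigenvalues of the smaller of its two Gram matrices, so that there are
   [minn m n] of them, counted with multiplicity.  The larger Gram matrix may
   have additional zero eigenvalues. *)
Definition singular_value (R : realType) (m n : nat) (A : 'M[R]_(m, n)) (s : R)
    : Prop :=
  0 <= s /\ (if (n <= m)%N then eigenvalue (A^T *m A) (s ^+ 2)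
             else eigenvalue (A *m A^T) (s ^+ 2)).

(* The set of singular values is finite, and nonempty when [m] and [n] are
   positive, so the infimum and the supremum are a minimum and a maximum;
   see [sigma_minP] and [sigma_maxP]. *)
Definition sigma_min (R : realType) (m n : nat) (A : 'M[R]_(m, n)) : R :=
  inf [set s | singular_value A s].

Definition sigma_max (R : realType) (m n : nat) (A : 'M[R]_(m, n)) : R :=
  sup [set s | singular_value A s].

Definition proj (R : realType) (n z : nat) (A : 'M[R]_n) (Z : 'M[R]_(n, z))
    : 'M[R]_n :=
  Z *m invmx (Z^T *m A *m Z) *m Z^T *m A.

(* The projector for the pseudometric [C^T *m C]. *)
Definition pseudo_proj (R : realType) (n q z : nat) (C : 'M[R]_(q, n))
    (Z : 'M[R]_(n, z)) : 'M[R]_n :=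
  Z *m mpinv (C *m Z) *m C.

Definition energy_weights (R : realType) (n z : nat) (A : 'M[R]_n)
    (b xbar : 'cV[R]_n) (Z : 'M[R]_(n, z)) : 'cV[R]_z :=
  invmx (Z^T *m A *m Z) *m Z^T *m (b - A *m xbar).

Definition pseudo_weights (R : realType) (n q z : nat) (C : 'M[R]_(q, n))
    (xstar xbar : 'cV[R]_n) (Z : 'M[R]_(n, z)) : 'cV[R]_z :=
  mpinv (C *m Z) *m C *m (xstar - xbar).

Section WellDefined.
Variable R : realType.

Lemma mul_tr_ge0 n (v : 'rV[R]_n) : 0 <= (v *m v^T) 0 0.
Proof. by rewrite mxE sumr_ge0 // => i _; rewrite mxE -expr2 sqr_ge0. Qed.

Lemma mul_tr_eq0 n (v : 'rV[R]_n) : (v *m v^T) 0 0 = 0 -> v = 0.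
Proof.
rewrite mxE => /eqP; rewrite psumr_eq0; last first.
  by move=> i _; rewrite mxE -expr2 sqr_ge0.
move=> /allP v0; apply/rowP => i; have := v0 i (mem_index_enum i).
by rewrite !mxE /= -expr2 sqrf_eq0 => /eqP.
Qed.

Lemma row_free_gram m n (U : 'M[R]_(m, n)) :
  row_free U -> U *m U^T \in unitmx.
Proof.
move=> fU; rewrite -row_free_unit; apply/inj_row_free => v vUU.
apply/eqP; rewrite -(mulmx_free_eq0 _ fU); apply/eqP/mul_tr_eq0.
by rewrite trmx_mul mulmxA -(mulmxA v) vUU mul0mx mxE.
Qed.

Lemma moore_penrose_factor m n r (L : 'M[R]_(m, r)) (U : 'M[R]_(r, n)) :
  row_full L -> row_free U -> exists X, is_moore_penrose (L *m U) X.
Proof.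
move=> fL fU.
have uU : U *m U^T \in unitmx by exact: row_free_gram.
have uL : L^T *m L \in unitmx.
  by rewrite -{2}[L]trmxK; apply: row_free_gram; rewrite /row_free mxrank_tr.
set X := U^T *m invmx (U *m U^T) *m (invmx (L^T *m L) *m L^T).
have AX : L *m U *m X = L *m invmx (L^T *m L) *m L^T.
  by rewrite /X -!mulmxA (mulmxA U U^T) (mulmxA (U *m U^T)) mulmxV // mul1mx.
have XA : X *m (L *m U) = U^T *m invmx (U *m U^T) *m U.
  by rewrite /X -!mulmxA (mulmxA L^T) (mulmxA (invmx (L^T *m L)))
    mulVmx // mul1mx.
exists X; split.
- by rewrite AX -!mulmxA (mulmxA L^T) (mulmxA (invmx _)) mulVmx // mul1mx.
- by rewrite XA /X -!mulmxA (mulmxA U U^T) (mulmxA (U *m U^T)) mulmxV // mul1mx.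
- by rewrite AX !(trmx_mul, trmx_inv, trmxK) mulmxA.
- by rewrite XA !(trmx_mul, trmx_inv, trmxK) mulmxA.
Qed.

Lemma moore_penrose_ex m n (A : 'M[R]_(m, n)) : exists X, is_moore_penrose A X.
Proof.
rewrite -(mulmx_base A).
exact: moore_penrose_factor (col_base_full A) (row_base_free A).
Qed.

Lemma mpinvP m n (A : 'M[R]_(m, n)) : is_moore_penrose A (mpinv A).
Proof.
have [X AX] := moore_penrose_ex A.
exact: (@xgetPex _ 0 [set X | is_moore_penrose A X] (ex_intro _ X AX)).
Qed.

Lemma moore_penrose_uniq m n (A : 'M[R]_(m, n)) X Y :
  is_moore_penrose A X -> is_moore_penrose A Y -> X = Y.
Proof.
move=> [AXA XAX AXt XAt] [AYA YAY AYt YAt].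
have AXY : A *m X = A *m Y.
  by rewrite -AXt -{1}AYA -(mulmxA _ A) trmx_mul AXt AYt mulmxA AXA.
have XYA : X *m A = Y *m A.
  have -> : X *m A = X *m A *m (Y *m A) by rewrite -mulmxA (mulmxA A) AYA.
  by rewrite -XAt -YAt -trmx_mul -mulmxA (mulmxA A) AXA.
by rewrite -XAX XYA -mulmxA AXY mulmxA.
Qed.

Lemma gram_eigenvalue_ex p k (B : 'M[R]_(p, k)) : (0 < p)%N ->
  exists s, 0 <= s /\ eigenvalue (B *m B^T) (s ^+ 2).
Proof.
move=> p_gt0; set G := B *m B^T.
have GT : G^T = G by rewrite trmx_mul trmxK.
pose f : {rmorphism R -> R[i]} := real_complex R.
have [a aG] := eigenvalue_closed (map_mx f G) p_gt0.
have /eigenvalueP [v vG v0] := aG.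
pose v' := map_mx Num.conj v.
have fG' : map_mx Num.conj (map_mx f G) = map_mx f G.
  by apply/matrixP => i j; rewrite !mxE; exact: conjc_real.
have a_real : a^* = a.
  have N0 : (v *m v'^T) 0 0 != 0.
    rewrite mxE psumr_eq0; last first.
      by move=> i _; rewrite !mxE mul_conjC_ge0.
    apply: contraNN v0 => /allP v0; apply/eqP/rowP => i.
    by have := v0 i (mem_index_enum i); rewrite !mxE /= mul_conjC_eq0 => /eqP.
  have v'G : v' *m map_mx f G = a^* *: v'.
    by rewrite -fG' -map_mxM vG map_mxZ.
  have : a * (v *m v'^T) 0 0 = a^* * (v *m v'^T) 0 0.
    have -> : a * (v *m v'^T) 0 0 = (v *m map_mx f G *m v'^T) 0 0.
      by rewrite vG -scalemxAl [RHS]mxE.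
    have -> : a^* * (v *m v'^T) 0 0 = (v *m (v' *m map_mx f G)^T) 0 0.
      by rewrite v'G linearZ -scalemxAr [RHS]mxE.
    by rewrite trmx_mul (map_trmx f) GT mulmxA.
  by move/(mulIf N0) => <-.
have /complex_realP[r ar] : a \is Num.real by apply/CrealP.
have rG : eigenvalue G r.
  by move: aG; rewrite ar !eigenvalue_root_char -(map_char_poly f) fmorph_root.
have /eigenvalueP [w wG w0] := rG.
have r_ge0 : 0 <= r.
  have ww : 0 < (w *m w^T) 0 0.
    rewrite lt_neqAle mul_tr_ge0 andbT eq_sym; apply: contraNN w0.
    by move=> /eqP /mul_tr_eq0 ->.
  rewrite -(pmulr_lge0 _ ww).
  have -> : r * (w *m w^T) 0 0 = ((w *m B) *m (w *m B)^T) 0 0.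
    rewrite trmx_mul mulmxA -(mulmxA w) -/G wG -scalemxAl [RHS]mxE //.
  exact: mul_tr_ge0.
by exists (Num.sqrt r); rewrite sqrtr_ge0 sqr_sqrtr.
Qed.

Lemma singular_value_ex m n (A : 'M[R]_(m, n)) : (0 < m)%N -> (0 < n)%N ->
  exists s, singular_value A s.
Proof.
move=> m0 n0; rewrite /singular_value; case: leqP => _.
  by have := @gram_eigenvalue_ex _ _ A^T n0; rewrite trmxK.
exact: gram_eigenvalue_ex.
Qed.

Lemma singular_value_finite m n (A : 'M[R]_(m, n)) :
  exists l : seq R, forall s, singular_value A s <-> s \in l.
Proof.
have H p (G : 'M[R]_p) : exists l : seq R, forall s,
    (0 <= s /\ eigenvalue G (s ^+ 2)) <-> s \in l.
  pose P := char_poly G \Po 'X^2.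
  have P0 : P != 0.
    by rewrite comp_poly_eq0 ?size_polyXn // monic_neq0 // char_poly_monic.
  exists [seq s <- rootsR P | 0 <= s] => s; rewrite mem_filter -(roots_on_rootsR P0) in_itv /=.
  rewrite eigenvalue_root_char /root horner_comp hornerXn.
  by split=> [[-> ->]|/andP[-> ->]].
by rewrite /singular_value; case: leqP => _; exact: H.
Qed.

Lemma seq_min (l : seq R) x : x \in l ->
  exists2 m, m \in l & forall y, y \in l -> m <= y.
Proof.
elim: l x => // a l IH x _; case: l IH => [|b l] IH.
  by exists a; rewrite ?mem_head // => y; rewrite inE => /eqP ->.
have [m ml mle] := IH b (mem_head _ _).
case: (leP a m) => am.
  exists a; first exact: mem_head.
  by move=> y; rewrite inE => /predU1P[->//|/mle]; exact: le_trans.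
exists m; first by rewrite inE ml orbT.
by move=> y; rewrite inE => /predU1P[->|/mle//]; exact: ltW.
Qed.

Lemma sigma_minP m n (A : 'M[R]_(m, n)) : (0 < m)%N -> (0 < n)%N ->
  singular_value A (sigma_min A) /\
  forall s, singular_value A s -> sigma_min A <= s.
Proof.
move=> m0 n0; have [l lP] := singular_value_finite A.
have [s0 /lP s0l] := singular_value_ex A m0 n0.
have [t /lP tA tle] := seq_min s0l.
have tlb : lbound [set s | singular_value A s] t by move=> s /lP /tle.
suff -> : sigma_min A = t by split.
apply/le_anti/andP; split; first by apply: ge_inf => //; exists t.
by apply: lb_le_inf => //; exists t.
Qed.

Lemma sigma_maxP m n (A : 'M[R]_(m, n)) : (0 < m)%N -> (0 < n)%N ->
  singular_value A (sigma_max A) /\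
  forall s, singular_value A s -> s <= sigma_max A.
Proof.
move=> m0 n0; have [l lP] := singular_value_finite A.
have [s0 /lP s0l] := singular_value_ex A m0 n0.
have s0l' : - s0 \in [seq - x | x <- l] by rewrite map_f.
have [_ /mapP[t tl ->] tle] := seq_min s0l'.
have tA : singular_value A t by exact/lP.
have tub : ubound [set s | singular_value A s] t.
  by move=> s /lP sl; rewrite -lerN2; apply/tle/map_f.
suff -> : sigma_max A = t by split.
apply/le_anti/andP; split; first by apply: ge_sup => //; exists t.
by apply: ub_le_sup => //; exists t.
Qed.

End WellDefined.

(* Main.v *)
Require Import Defs.
From mathcomp Require Import all_boot all_order all_algebra.
From mathcomp Require Import reals.
From mathcomp Require Import boolp classical_sets.
From mathcomp Require Import ring lra.

(** Write [d] and [d'] for the current and previous errors [xstar - xbar], and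
    [P'] for the previous projector.  Since [b = A xstar], the weights [w] of
    either kind satisfy [Z w = P d], where [P] is the projector of that kind;
    likewise [Z w' = P' d'] for the previous weights.  Hence
    [Z (w - w') = (P - P') d + P' (d - d')], and both estimates are the same
    statement about the pairs [(P, w)] and [(P', w')]
    ([weights_diff_le]).  It follows from the triangle inequality together
    with three norm bounds: the induced norm bounds the first summand
    ([vnorm_mulmx_le]), the largest singular value of [P'] bounds the second
    ([vnorm_mulmx_le_sigma_max]), and [sigma_min Z] times the norm of
    [w - w'] is at most the norm of its image under [Z]
    ([sigma_min_vnorm_le]).  Full column rank makes [sigma_min Z] positive
    when [Z] has columns, so that the last bound can be divided by it.

    The two singular value bounds need the extreme eigenvalues of a Gram
    matrix to be the extreme values of its Rayleigh quotient.  This part of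
    the spectral theorem is proved without diagonalization
    ([min_rayleigh]).  Let [r] be the largest number such that the form
    of [G - r] is nonnegative.  If [G - r] were invertible, the Cauchy-Schwarz
    inequality for this form would make it coercive
    ([psd_unit_coercive]), so that [r] could be increased.  Hence [r] is an
    eigenvalue. *)

Set Implicit Arguments.
Unset Strict Implicit.
Unset Printing Implicit Defensive.

Import Order.TTheory GRing.Theory Num.Theory.
Local Open Scope ring_scope.

(** * Scalar product and Cauchy-Schwarz inequality *)

Section WeightBounds.
Variable R : realType.

Definition dotv n (x y : 'cV[R]_n) : R := (x^T *m y) 0 0.

Lemma dotvC n (x y : 'cV[R]_n) : dotv x y = dotv y x.
Proof. by rewrite /dotv -[in RHS](trmxK x) -trmx_mul [RHS]mxE. Qed.

Lemma dotvDr n (x y1 y2 : 'cV[R]_n) :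
  dotv x (y1 + y2) = dotv x y1 + dotv x y2.
Proof. by rewrite /dotv mulmxDr mxE. Qed.

Lemma dotv0 n (x : 'cV[R]_n) : dotv x 0 = 0.
Proof. by rewrite /dotv mulmx0 mxE. Qed.

Lemma dotvZr n a (x y : 'cV[R]_n) : dotv x (a *: y) = a * dotv x y.
Proof. by rewrite /dotv -scalemxAr mxE. Qed.

Lemma dotvDl n (x1 x2 y : 'cV[R]_n) :
  dotv (x1 + x2) y = dotv x1 y + dotv x2 y.
Proof. by rewrite !(dotvC _ y) dotvDr. Qed.

Lemma dotvZl n a (x y : 'cV[R]_n) : dotv (a *: x) y = a * dotv x y.
Proof. by rewrite !(dotvC _ y) dotvZr. Qed.

Lemma dotv_mull m n (M : 'M[R]_(m, n)) (x : 'cV[R]_n) (y : 'cV[R]_m) :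
  dotv (M *m x) y = dotv x (M^T *m y).
Proof. by rewrite /dotv trmx_mul mulmxA. Qed.

Lemma dotvvE n (x : 'cV[R]_n) : dotv x x = \sum_(i < n) x i 0 ^+ 2.
Proof. by rewrite /dotv mxE; apply: eq_bigr => i _; rewrite mxE expr2. Qed.

Lemma dotvv_ge0 n (x : 'cV[R]_n) : 0 <= dotv x x.
Proof. by rewrite dotvvE sumr_ge0 // => i _; rewrite sqr_ge0. Qed.

Lemma dotvv_gt0 n (x : 'cV[R]_n) : x != 0 -> 0 < dotv x x.
Proof.
move=> x0; rewrite lt_neqAle dotvv_ge0 andbT eq_sym.
apply: contraNN x0 => /eqP xx0; rewrite -[x]trmxK.
by rewrite (_ : x^T = 0) ?trmx0 //; apply: mul_tr_eq0; rewrite trmxK.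
Qed.

Lemma dotv_gram m n (M : 'M[R]_(m, n)) (x : 'cV[R]_n) :
  dotv x (M^T *m M *m x) = dotv (M *m x) (M *m x).
Proof. by rewrite dotv_mull mulmxA. Qed.

(** The form may be degenerate: coercivity will be deduced from this inequality,
    so it cannot be assumed here. *)
Lemma form_cauchy_schwarz n (M : 'M[R]_n) (x y : 'cV[R]_n) :
  M^T = M -> (forall u, 0 <= dotv u (M *m u)) ->
  dotv x (M *m y) ^+ 2 <= dotv x (M *m x) * dotv y (M *m y).
Proof.
move=> Msym M_ge0; set a := dotv x (M *m x); set c := dotv y (M *m y).
set b := dotv x (M *m y).
have quad t : 0 <= a + 2 * t * b + t ^+ 2 * c.
  have := M_ge0 (x + t *: y).
  rewrite mulmxDr -scalemxAr !(dotvDl, dotvDr, dotvZl, dotvZr).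
  rewrite -/a -/b -/c (_ : dotv y (M *m x) = b).
    by congr (_ <= _); ring.
  by rewrite dotvC dotv_mull Msym.
have a0 : 0 <= a := M_ge0 x.
have := M_ge0 y; rewrite -/c le_eqVlt => /predU1P[c0|c0].
  have [->|b0] := eqVneq b 0; first by rewrite expr0n -c0 mulr0.
  (* When [c = 0] the quadratic is affine; this [t] is where it equals [-1]. *)
  have := quad (- (a + 1) / (2 * b)); rewrite -c0 mulr0 addr0.
  have -> : a + 2 * (- (a + 1) / (2 * b)) * b = -1 by field.
  by rewrite lerNr oppr0 ler10.
(* The minimum of the quadratic is reached at [t = - b / c]. *)
have := quad (- b / c).
have -> : a + 2 * (- b / c) * b + (- b / c) ^+ 2 * c = (a * c - b ^+ 2) / c.
  by field; rewrite gt_eqF.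
by rewrite pmulr_lge0 ?invr_gt0 // subr_ge0.
Qed.

Lemma cauchy_schwarz n (x y : 'cV[R]_n) :
  dotv x y ^+ 2 <= dotv x x * dotv y y.
Proof.
have := @form_cauchy_schwarz n 1%:M x y (trmx1 _ _).
by rewrite !mul1mx; apply => u; rewrite mul1mx dotvv_ge0.
Qed.

(** A crude form of the arithmetic-geometric mean inequality; linear in the
    squared norms, it spares square roots when the constant is irrelevant. *)
Lemma norm_dotv_le n (x y : 'cV[R]_n) : `|dotv x y| <= dotv x x + dotv y y.
Proof.
have := cauchy_schwarz x y; have := dotvv_ge0 x; have := dotvv_ge0 y.
move: (dotv x x) (dotv y y) (dotv x y) => a c b c0 a0 bac.
rewrite -ler_sqr ?nnegrE ?addr_ge0 // real_normK ?num_real //.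
nra.
Qed.

(** By Cauchy-Schwarz on each row, the squared Frobenius norm of [M] is such a
    constant. *)
Lemma mulmx_bounded m n (M : 'M[R]_(m, n)) :
  exists2 K, 0 <= K &
    forall x, dotv (M *m x) (M *m x) <= K * dotv x x.
Proof.
exists (\sum_i dotv (row i M)^T (row i M)^T).
  by apply: sumr_ge0 => i _; exact: dotvv_ge0.
move=> x; rewrite [leLHS]dotvvE mulr_suml; apply: ler_sum => i _.
have -> : (M *m x) i 0 = dotv (row i M)^T x.
  by rewrite /dotv trmxK -row_mul [RHS]mxE.
exact: cauchy_schwarz.
Qed.

(** * Extreme eigenvalues of symmetric matrices *)

(** With [M y = x], Cauchy-Schwarz for the form of [M] bounds the square of
    [dotv x x] by the product of the form at [x] and of [dotv y x]; the latter
    is at most a multiple of [dotv x x] because the inverse of [M] is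
    bounded. *)
Lemma psd_unit_coercive n (M : 'M[R]_n) :
  M^T = M -> (forall u, 0 <= dotv u (M *m u)) -> M \in unitmx ->
  exists2 e, 0 < e & forall x, e * dotv x x <= dotv x (M *m x).
Proof.
move=> Msym M_ge0 Mu; have [K K0 MK] := mulmx_bounded (invmx M).
exists (K + 1)^-1; first by rewrite invr_gt0; lra.
move=> x; rewrite mulrC ler_pdivrMr; last by lra.
have [->|/dotvv_gt0 xx] := eqVneq x 0.
  by rewrite mulmx0 dotv0 mul0r.
rewrite -(ler_pM2l xx) -expr2.
set y := invmx M *m x; have Myx : M *m y = x by rewrite mulKVmx.
have := form_cauchy_schwarz x y Msym M_ge0; rewrite Myx => /le_trans; apply.
have yx : dotv y x <= (K + 1) * dotv x x.
  rewrite (le_trans (ler_norm _)) // (le_trans (norm_dotv_le _ _)) //.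
  by rewrite mulrDl mul1r lerD2r MK.
have := M_ge0 x; nra.
Qed.

Lemma eigenvalue_notin_unitmx n (G : 'M[R]_n) r :
  eigenvalue G r = (G - r%:M \notin unitmx).
Proof. by rewrite /eigenvalue /eigenspace kermx_eq0 row_free_unit. Qed.

(** The eigenvalue is the supremum [r] of the lower bounds [S] of the Rayleigh
    quotient.  It belongs to [S], so [G - r] is positive semidefinite; if
    [G - r] were a unit it would be coercive with some constant [e > 0], and
    [r + e] would also be in [S]. *)
Lemma min_rayleigh n (G : 'M[R]_n) : (0 < n)%N -> G^T = G ->
  exists2 r, eigenvalue G r & forall x, r * dotv x x <= dotv x (G *m x).
Proof.
case: n G => // n G _ Gsym.
pose S := [set r : R | forall x, r * dotv x x <= dotv x (G *m x)]%classic.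
have [K K0 GK] := mulmx_bounded G.
have S_sup : has_sup S.
  split.
    exists (- (1 + K)) => x; rewrite mulNr lerNl.
    rewrite (le_trans (ler_norm _)) // normrN (le_trans (norm_dotv_le _ _)) //.
    by rewrite mulrDl mul1r lerD2l.
  pose e : 'cV[R]_n.+1 := delta_mx 0 0.
  exists (dotv e (G *m e)) => r /(_ e).
  by rewrite {1}/dotv trmx_delta mul_delta_mx mxE !eqxx mulr1.
have supS : S (sup S).
  move=> x; have [->|/dotvv_gt0 xx] := eqVneq x 0.
    by rewrite mulmx0 dotv0 mulr0.
  rewrite -ler_pdivlMr //; apply: ge_sup; first exact: S_sup.1.
  by move=> r Sr; rewrite ler_pdivlMr //; exact: Sr.
exists (sup S) => //; rewrite eigenvalue_notin_unitmx; apply/negP => uM.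
set M := G - _ in uM.
have ME x : dotv x (M *m x) = dotv x (G *m x) - sup S * dotv x x.
  by rewrite /M mulmxBl mul_scalar_mx dotvDr -scaleNr dotvZr mulNr.
have [e e0 Me] : exists2 e, 0 < e & forall x, e * dotv x x <= dotv x (M *m x).
  apply: psd_unit_coercive => //.
    by rewrite /M linearB /= tr_scalar_mx Gsym.
  by move=> u; rewrite ME subr_ge0; exact: supS.
have /(ub_le_sup S_sup.2) : S (sup S + e).
  by move=> x; have := Me x; rewrite ME lerBrDl mulrDl.
by rewrite gerDl leNgt e0.
Qed.

Lemma max_rayleigh n (G : 'M[R]_n) : (0 < n)%N -> G^T = G ->
  exists2 r, eigenvalue G r & forall x, dotv x (G *m x) <= r * dotv x x.
Proof.
move=> n0 Gsym; have [|r Gr rG] := @min_rayleigh _ (- G) n0.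
  by rewrite linearN /= Gsym.
exists (- r).
  have /eigenvalueP[v vG v0] := Gr; apply/eigenvalueP; exists v => //.
  by rewrite scaleNr -vG mulmxN opprK.
move=> x; have := rG x.
by rewrite mulNmx -scaleN1r dotvZr mulN1r mulNr lerNr.
Qed.

(** * Norm bounds *)

Lemma vnormE n (x : 'cV[R]_n) : vnorm x = Num.sqrt (dotv x x).
Proof. by rewrite dotvvE. Qed.

Lemma vnorm_ge0 n (x : 'cV[R]_n) : 0 <= vnorm x.
Proof. exact: sqrtr_ge0. Qed.

Lemma sqr_vnorm n (x : 'cV[R]_n) : vnorm x ^+ 2 = dotv x x.
Proof. by rewrite vnormE sqr_sqrtr // dotvv_ge0. Qed.

Lemma vnorm0 n : vnorm (0 : 'cV[R]_n) = 0.
Proof. by rewrite vnormE dotv0 sqrtr0. Qed.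

Lemma vnorm_gt0 n (x : 'cV[R]_n) : x != 0 -> 0 < vnorm x.
Proof. by move=> x0; rewrite vnormE sqrtr_gt0 dotvv_gt0. Qed.

Lemma vnormZ n a (x : 'cV[R]_n) : vnorm (a *: x) = `|a| * vnorm x.
Proof.
by rewrite !vnormE dotvZl dotvZr mulrA -expr2 sqrtrM ?sqr_ge0 // sqrtr_sqr.
Qed.

Lemma vnormD n (x y : 'cV[R]_n) : vnorm (x + y) <= vnorm x + vnorm y.
Proof.
rewrite -ler_sqr ?nnegrE ?addr_ge0 ?vnorm_ge0 //.
rewrite sqr_vnorm !(dotvDl, dotvDr) (dotvC y x).
have xy : dotv x y <= vnorm x * vnorm y.
  rewrite (le_trans (ler_norm _)) // -ler_sqr ?nnegrE ?mulr_ge0 ?vnorm_ge0 //.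
  by rewrite real_normK ?num_real // exprMn !sqr_vnorm cauchy_schwarz.
rewrite -!sqr_vnorm; nra.
Qed.

(** Boundedness of [M] on the unit ball is needed for the supremum defining
    [mnorm] to be an upper bound. *)
Lemma vnorm_mulmx_le m n (M : 'M[R]_(m, n)) x :
  vnorm (M *m x) <= mnorm M * vnorm x.
Proof.
have [->|x0] := eqVneq x 0; first by rewrite mulmx0 !vnorm0 mulr0.
rewrite -ler_pdivrMr ?vnorm_gt0 //; apply: ub_le_sup.
  have [K K0 MK] := mulmx_bounded M; exists (Num.sqrt K) => _ [y /= y1 <-].
  rewrite vnormE ler_sqrt // (le_trans (MK y)) // ler_piMr //.
  by rewrite -sqr_vnorm expr_le1 // vnorm_ge0.
exists ((vnorm x)^-1 *: x) => /=.
  rewrite vnormZ ger0_norm ?invr_ge0 ?vnorm_ge0 // mulVf //.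
  by rewrite gt_eqF // vnorm_gt0.
by rewrite -scalemxAr vnormZ ger0_norm ?invr_ge0 ?vnorm_ge0 // mulrC.
Qed.

(** The least eigenvalue of [Z^T Z] is the square of a singular value, because
    [n <= m] makes this the Gram matrix that [singular_value] refers to.  For
    [m < n] the inequality fails in general, since [Z] has a kernel. *)
Lemma sigma_min_vnorm_le m n (Z : 'M[R]_(m, n)) x : (n <= m)%N ->
  sigma_min Z * vnorm x <= vnorm (Z *m x).
Proof.
case: n Z x => [|n] Z x nm.
  by rewrite (flatmx0 x) vnorm0 mulr0 vnorm_ge0.
have [[s0 _] sle] := @sigma_minP R _ _ Z (leq_trans (ltn0Sn _) nm) (ltn0Sn _).
have [|r Zr rZ] := @min_rayleigh _ (Z^T *m Z) (ltn0Sn n).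
  by rewrite trmx_mul trmxK.
have r0 : 0 <= r.
  have /eigenvalueP[v vr v0] := Zr.
  have vt0 : v^T != 0.
    by apply: contraNN v0 => /eqP/(congr1 trmx)/=; rewrite trmxK trmx0 => ->.
  rewrite -(pmulr_lge0 _ (dotvv_gt0 vt0)) -dotvZr.
  have -> : r *: v^T = Z^T *m Z *m v^T.
    by rewrite -linearZ /= -vr !trmx_mul trmxK.
  by rewrite dotv_gram dotvv_ge0.
have sr : sigma_min Z <= Num.sqrt r.
  by apply: sle; rewrite /singular_value nm sqrtr_ge0 sqr_sqrtr.
rewrite -ler_sqr ?nnegrE ?mulr_ge0 ?vnorm_ge0 // exprMn !sqr_vnorm.
rewrite -dotv_gram; apply: le_trans (rZ x).
rewrite ler_wpM2r ?dotvv_ge0 // -(sqr_sqrtr r0).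
by rewrite ler_sqr ?nnegrE ?sqrtr_ge0.
Qed.

Lemma vnorm_mulmx_le_sigma_max n (P : 'M[R]_n) x :
  vnorm (P *m x) <= sigma_max P * vnorm x.
Proof.
have [->|x0] := eqVneq x 0; first by rewrite mulmx0 !vnorm0 mulr0.
have n0 : (0 < n)%N.
  by rewrite lt0n; apply: contraNneq x0 => n0; subst n; rewrite (flatmx0 x).
have [[s0 _] ges] := @sigma_maxP R _ _ P n0 n0.
have [|r Pr rP] := @max_rayleigh _ (P^T *m P) n0.
  by rewrite trmx_mul trmxK.
have r0 : 0 <= r.
  rewrite -(pmulr_lge0 _ (dotvv_gt0 x0)); apply: le_trans (rP x).
  by rewrite dotv_gram dotvv_ge0.
have sr : Num.sqrt r <= sigma_max P.
  by apply: ges; rewrite /singular_value leqnn sqrtr_ge0 sqr_sqrtr.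
rewrite -ler_sqr ?nnegrE ?mulr_ge0 ?vnorm_ge0 // exprMn !sqr_vnorm.
rewrite -dotv_gram; apply: le_trans (rP x) _.
rewrite ler_wpM2r ?dotvv_ge0 // -(sqr_sqrtr r0).
by rewrite ler_sqr ?nnegrE ?sqrtr_ge0.
Qed.

Lemma sigma_min_gt0 m n (Z : 'M[R]_(m, n)) : (0 < n)%N -> \rank Z = n ->
  0 < sigma_min Z.
Proof.
move=> n0 rZ; have nm : (n <= m)%N by rewrite -rZ rank_leq_row.
have [[s0 sZ] _] := @sigma_minP R _ _ Z (leq_trans n0 nm) n0.
rewrite lt_neqAle s0 andbT eq_sym; apply: contraTneq sZ => ->.
rewrite nm expr0n eigenvalue_notin_unitmx /= raddf0 subr0 negbK.
rewrite -{2}[Z]trmxK; apply: row_free_gram.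
by rewrite /row_free mxrank_tr rZ.
Qed.

(** If [n = 0] there is no singular value, and [sigma_min Z], the infimum of the
    empty set, is [0]; both sides of the conclusion then vanish. *)
Lemma vnorm_le_mulmx_div_sigma_min m n (Z : 'M[R]_(m, n)) x B : \rank Z = n ->
  vnorm (Z *m x) <= B -> vnorm x <= (sigma_min Z)^-1 * B.
Proof.
move=> rZ ZB; have nm : (n <= m)%N by rewrite -rZ rank_leq_row.
have [n0|n0] := posnP n.
  suff -> : sigma_min Z = 0 by subst n; rewrite invr0 mul0r (flatmx0 x) vnorm0.
  rewrite /sigma_min (_ : mkset _ = set0) ?inf0 //.
  subst n; apply/seteqP; split=> // s [_] /eigenvalueP[v _].
  by rewrite (thinmx0 v) eqxx.
rewrite ler_pdivlMl ?sigma_min_gt0 //.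
exact: le_trans (sigma_min_vnorm_le Z x nm) ZB.
Qed.

(** * Weights *)

Lemma energy_weightsE n z (A : 'M[R]_n) (Z : 'M[R]_(n, z)) b xbar xstar :
  A *m xstar = b ->
  Z *m energy_weights A b xbar Z = proj A Z *m (xstar - xbar).
Proof. by move=> <-; rewrite /proj /energy_weights -mulmxBr !mulmxA. Qed.

(** The error splits as [Z (w - wp) = (P - Pp) d + Pp (d - dp)]: the change of
    projector acts on the current error, and the previous projector acts on
    the change of error. *)
Lemma weights_diff_le n z (Z : 'M[R]_(n, z)) (P Pp : 'M[R]_n) w wp d dp :
  \rank Z = z -> Z *m w = P *m d -> Z *m wp = Pp *m dp ->
  vnorm (w - wp) <= (sigma_min Z)^-1 *
    (mnorm (P - Pp) * vnorm d + sigma_max Pp * vnorm (d - dp)).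
Proof.
move=> rZ Zw Zwp; apply: vnorm_le_mulmx_div_sigma_min => //.
have -> : Z *m (w - wp) = (P - Pp) *m d + Pp *m (d - dp).
  by rewrite mulmxBr Zw Zwp mulmxBl mulmxBr addrA subrK.
apply: le_trans (vnormD _ _) _.
by rewrite lerD ?vnorm_mulmx_le ?vnorm_mulmx_le_sigma_max.
Qed.

End WeightBounds.

Theorem theorem3p3 (R : realType) (n q z : nat)
  (A_prev A : 'M[R]_n) (b_prev b xbar_prev xbar xstar_prev xstar : 'cV[R]_n)
  (C : 'M[R]_(q, n)) (Z : 'M[R]_(n, z))
  (hA_prev : spd A_prev) (hA : spd A)
  (hxstar_prev : A_prev *m xstar_prev = b_prev) (hxstar : A *m xstar = b)
  (hZ : \rank Z = z) :
  vnorm (energy_weights A b xbar Z - energy_weights A_prev b_prev xbar_prev Z)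
    <= (sigma_min Z)^-1 *
       (mnorm (proj A Z - proj A_prev Z) * vnorm (xstar - xbar)
        + sigma_max (proj A_prev Z)
          * vnorm ((xstar - xbar) - (xstar_prev - xbar_prev)))
  /\
  vnorm (pseudo_weights C xstar xbar Z
         - energy_weights A_prev b_prev xbar_prev Z)
    <= (sigma_min Z)^-1 *
       (mnorm (pseudo_proj C Z - proj A_prev Z) * vnorm (xstar - xbar)
        + sigma_max (proj A_prev Z)
          * vnorm ((xstar - xbar) - (xstar_prev - xbar_prev))).
Proof.
split; apply: weights_diff_le => //;
  rewrite ?(energy_weightsE _ _ hxstar) ?(energy_weightsE _ _ hxstar_prev) //.
by rewrite /pseudo_proj /pseudo_weights !mulmxA.
Qed.
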